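(* Let $n\ge 1$ be an integer. If the secret $\sigma\in S_n$ is chosen uniformly at random, then the expected number of guesses for the strategy CircularShift to solve $\sigma$ in Permutation Wordle on $[n]$ is $(n+1)/2$.
   Context: Let $[n]=\{1,\dots,n\}$ and let $S_n$ be the group of permutations of $[n]$. Permutation Wordle: a setter fixes a secret $\sigma\in S_n$. In round $r=1,2,\dots$ the guesser submits a word $\gamma_r\in[n]^n$, regarded as a function $\gamma_r:[n]\to[n]$ from positions to values, and receives the feedback $U_r=\{i\in[n] : \gamma_r(i)=\sigma(i)\}$. The guess $\gamma_{r+1}$ may depend on $U_1,\dots,U_r$. The number of guesses taken to solve $\sigma$ is the least $r\ge1$ with $\gamma_r=\sigma$. CircularShift is the following deterministic strategy. The first guess $\gamma_1$ is the identity permutation. After submitting $\gamma_r$ and receiving $U_r$: if $U_r=[n]$, stop (the secret is solved in $r$ rounds). Otherwise write $[n]\setminus U_r=\{a_1<\cdots<a_\ell\}$ and define $\gamma_{r+1}(i)=\gamma_r(i)$ if $i\in U_r$; $\gamma_{r+1}(a_j)=\gamma_r(a_{j-1})$ for $1<j\le \ell$; and $\gamma_{r+1}(a_1)=\gamma_r(a_\ell)$. *)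

(* Defs.v *)
From HB Require Import structures.
From mathcomp Require Import all_boot all_order all_fingroup all_algebra.

Set Implicit Arguments.
Unset Strict Implicit.
Unset Printing Implicit Defensive.

Import Order.TTheory GRing.Theory Num.Theory.

(* The set [n] is represented by 'I_n = {0, ..., n-1}, an
   order-preserving relabelling of both positions and values. *)

Definition word (n : nat) := {ffun 'I_n -> 'I_n}.

Definition feedback (n : nat) (s : 'S_n) (g : word n) : {set 'I_n} :=
  [set i | g i == s i].

(* A deterministic strategy maps the feedback sets [:: U_1; ...; U_r], in
   chronological order, to the guess of round r + 1. *)
Definition strategy (n : nat) := seq {set 'I_n} -> word n.

(* The sequence [:: U_1; ...; U_r] received when P plays against s. *)
Fixpoint history (n : nat) (P : strategy n) (s : 'S_n) (r : nat) :
    seq {set 'I_n} :=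
  if r is q.+1 then
    let h := history P s q in rcons h (feedback s (P h))
  else [::].

(* Rounds are numbered from 1; the value at r = 0 is never used. *)
Definition guess (n : nat) (P : strategy n) (s : 'S_n) (r : nat) : word n :=
  P (history P s r.-1).

Definition solved_at (n : nat) (P : strategy n) (s : 'S_n) (r : nat) : Prop :=
  0 < r /\ guess P s r = [ffun i => s i].

Definition solved_in (n : nat) (P : strategy n) (s : 'S_n) (r : nat) : Prop :=
  solved_at P s r /\ forall q : nat, solved_at P s q -> r <= q.

(* [enum (~: U)] lists the complement a_1 < ... < a_l of U in increasing order,
   and [prev] is the predecessor in that list read cyclically: a_j is sent to
   a_(j-1) for 1 < j, and a_1 to a_l.  For U = setT, where play stops, this
   repeats the correct guess, which does not affect the first solving round. *)
Definition shift_word (n : nat) (g : word n) (U : {set 'I_n}) : word n :=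
  [ffun i => if i \in U then g i else g (prev (enum (~: U)) i)].

Definition circular_shift (n : nat) : strategy n :=
  foldl (@shift_word n) [ffun i => i].

Local Open Scope ring_scope.

(* Expectation of X at a uniformly distributed element of T. *)
Definition uniform_expectation (T : finType) (X : T -> rat) : rat :=
  \sum_(t : T) #|T|%:R^-1 * X t.

(* Main.v *)
Require Import Defs.
From HB Require Import structures.
From mathcomp Require Import all_boot all_order all_fingroup all_algebra.

(** The number of guesses has a closed form: CircularShift solves [s] in
    exactly [1 + exc s] rounds, where [exc s] counts the positions [i] with
    [i < s i] (lemma [solved_in_excedances]).

    To see this, look at the value displayed at each position and at its
    target, the position [s^-1 (g i)] where this value belongs, and count the
    values lying strictly to the right of their target.  A round moves every
    unsolved value to the next unsolved position, and its target is itself an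
    unsolved position different from the present one; so a value that moves
    one step to the right cannot jump over its target, and it lies to the
    right of the target after the move iff it did so before.  The exception is
    the value at the last unsolved position: it lies to the right of its
    target, and wrapping around to the first unsolved position brings it to
    the left of the target or onto it.  Hence each round decreases the count
    by exactly one until the word is solved ([overshoots_shift]).  The count vanishes exactly when the
    word is solved ([solved_overshoots]), and it starts at [exc s], because the
    identity word shows the value [v] at position [v] and the target of [s i]
    is [i].

    The mean of [exc] follows by linearity: for a fixed [i] the value [s i] is
    uniformly distributed ([sum_perm_eval]), so the mean is [1/n] times the
    number [n (n - 1) / 2] of pairs [i < j], that is [(n - 1) / 2]. *)

Set Implicit Arguments.
Unset Strict Implicit.
Unset Printing Implicit Defensive.

Import Order.TTheory GRing.Theory Num.Theory.
Local Open Scope ring_scope.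

Lemma sorted_enum_ord (n : nat) (A : {set 'I_n}) :
  sorted (fun i j : 'I_n => (i < j)%N) (enum A).
Proof.
rewrite /enum_mem -enumT; apply: sorted_filter => [j i k|]; first exact: ltn_trans.
by have := iota_ltn_sorted 0 n; rewrite -val_enum_ord sorted_map.
Qed.

(** All that the dynamics needs to know about the cyclic predecessor: either
    [i] is the first element of [A], and its predecessor is the last one, or no
    element of [A] lies strictly between the predecessor and [i]. *)
Lemma prev_enum_ord (n : nat) (A : {set 'I_n}) (i : 'I_n) : i \in A ->
  {in A, forall t : 'I_n, (i <= t <= prev (enum A) i)%N} \/
  {in A, forall t : 'I_n, (t < i)%N = (t <= prev (enum A) i)%N}.
Proof.
move=> iA; pose lt (j k : 'I_n) := (j < k)%N.
have lt_tr : transitive lt by move=> j k l; apply: ltn_trans.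
have := sorted_enum_ord A; have := enum_uniq A; have := mem_enum A.
move: iA; rewrite -mem_enum.
case: (enum A) => [|y q] // iq memE uq srt.
have idx : {in y :: q &, forall j k : 'I_n,
    (index j (y :: q) < index k (y :: q))%N = (j < k)%N}.
  move=> j k jq kq; apply/idP/idP; first exact: (sorted_ltn_index lt_tr srt).
  apply: contraTT; rewrite -!leqNgt leq_eqVlt => /orP[/eqP/index_inj -> //|].
  by move/(sorted_ltn_index lt_tr srt) => /(_ kq jq) /ltnW.
rewrite prev_nth iq.
have iqs : (index i q < size (y :: q))%N by rewrite /= ltnS index_size.
have idxp : index (nth y (y :: q) (index i q)) (y :: q) = index i q.
  by rewrite index_uniq.
have pq : nth y (y :: q) (index i q) \in y :: q by rewrite mem_nth.
move: pq idxp; set p := nth _ _ _ => pq idxp.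
have [yi|yi] := eqVneq y i.
  left=> t; rewrite -memE => tq; rewrite (leqNgt i) (leqNgt t) -!idx // idxp.
  (* The first element is absent from the tail, and looking it up there returns
     the size of the tail, which is the index of the last element. *)
  have -> : index i q = size q.
    by apply/eqP; rewrite eqn_leq index_size leqNgt index_mem -yi; case/andP: uq.
  rewrite -yi; apply/andP; split; first by rewrite /= eqxx.
  by rewrite -leqNgt -ltnS; move: tq; rewrite -index_mem.
right=> t; rewrite -memE => tq; rewrite (leqNgt t) -!idx // idxp -leqNgt.
by rewrite {2}/index /= (negPf yi) ltnS.
Qed.

(** As [s^-1%g (g i)] is the target of the value at [i], these are the values
    still on their way around the right end; their number measures the
    remaining work. *)
Definition overshoots (n : nat) (s : 'S_n) (g : word n) : {set 'I_n} :=
  [set i | (s^-1%g (g i) < i)%N].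

Definition excedances (n : nat) (s : 'S_n) : {set 'I_n} :=
  [set i : 'I_n | (i < s i)%N].

Section Round.

Variables (n : nat) (s : 'S_n) (g : word n).
Hypothesis g_inj : injective g.

Let A := ~: feedback s g.
Let target i := (s^-1)%g (g i).

Lemma unsolvedE i : (i \in A) = (target i != i).
Proof.
by rewrite !inE /target -(inj_eq (@perm_inj _ s)) permKV.
Qed.

(** The place of an unsolved value cannot be occupied by another, correct value,
    since no value occurs twice in the word. *)
Lemma unsolved_target i : i \in A -> target i \in A.
Proof.
by rewrite !unsolvedE; apply: contraNneq => /perm_inj/g_inj ->.
Qed.

Lemma overshoots_unsolved : overshoots s g \subset A.
Proof.
by apply/subsetP => i; rewrite inE unsolvedE -/(target i) -val_eqE ltn_neqAle => /andP[].
Qed.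

(** The target of the value at the last unsolved position is a different
    unsolved position, hence an earlier one. *)
Lemma last_unsolved a : a \in A ->
  exists2 m, m \in overshoots s g & {in A, forall t : 'I_n, (t <= m)%N}.
Proof.
move=> aA; case: (arg_maxnP (fun i : 'I_n => i : nat) aA) => m mA m_max.
exists m; last exact: m_max.
rewrite inE ltn_neqAle (m_max _ (unsolved_target mA) : (_ <= _)%N) andbT.
by rewrite -[_ == _]/(target m == m) -unsolvedE.
Qed.

Lemma shift_word_inj : injective (shift_word g (feedback s g)).
Proof.
move=> i j; rewrite !ffunE -/A.
have pA k : (prev (enum A) k \in feedback s g) = (k \in feedback s g).
  by have := mem_prev (enum A) k; rewrite !mem_enum !inE => /negb_inj.
case: ifP => iU; case: ifP => jU /g_inj // ij.
- by move: jU; rewrite -pA -ij iU.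
- by move: iU; rewrite -pA ij jU.
- exact: (can_inj (next_prev (enum_uniq A))).
Qed.

(** The cyclic predecessor injects the overshoots of the new word into those of
    the old one: a value stepping to the right does not jump over its target,
    which is unsolved.  Only the last unsolved position is missed, since its
    value wraps around. *)
Lemma overshoots_shift :
  #|overshoots s (shift_word g (feedback s g))| = #|overshoots s g|.-1.
Proof.
set g' := shift_word _ _.
(* A solved word is left unchanged and has no overshoot, so the truncated
   predecessor covers this case too. *)
have [A0|[a aA]] := set_0Vmem A.
  have U i : i \in feedback s g by have := in_set0 i; rewrite -A0 inE => /negbFE.
  have -> : g' = g by apply/ffunP => i; rewrite ffunE U.
  by move: overshoots_unsolved; rewrite A0 subset0 => /eqP ->; rewrite cards0.
pose p := prev (enum A).
have p_inj : injective p by exact: (can_inj (next_prev (enum_uniq A))).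
have pA k : (p k \in A) = (k \in A) by have := mem_prev (enum A) k; rewrite !mem_enum.
have [m m_over m_max] := last_unsolved aA.
have mA := subsetP overshoots_unsolved m m_over.
have g'A i : i \in A -> g' i = g (p i).
  by rewrite ffunE inE => /negPf ->.
have over'A : overshoots s g' \subset A.
  apply/subsetP => i; rewrite inE; apply: contraLR => iA.
  move: (iA); rewrite /g' ffunE inE negbK => iU; rewrite iU -leqNgt.
  by move: iA; rewrite unsolvedE negbK /target => /eqP ->.
rewrite -(card_imset _ p_inj) [#|overshoots s g|](cardsD1 m) m_over add1n /=.
suff over'E k : (k \in overshoots s g') = (p k \in overshoots s g :\ m).
  apply: eq_card => j; rewrite -[j](prev_next (enum_uniq A)) -/p.
  by rewrite mem_imset // over'E.
have [kA|kA] := boolP (k \in A); last first.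
  rewrite (contraNF (subsetP over'A k) kA) in_setD1; apply/esym/negbTE.
  rewrite negb_and (contra (subsetP overshoots_unsolved (p k))) ?orbT //.
  by rewrite pA.
rewrite in_setD1 !inE g'A //.
have pkA : p k \in A by rewrite pA.
have tA := unsolved_target pkA.
have tN : target (p k) != p k by rewrite -unsolvedE.
move: tA tN; rewrite /target; set t := s^-1%g _ => tA tN.
(* The value now at [k], with target [t], comes from [p k]. *)
have [h|h] := prev_enum_ord kA; rewrite -/p in h.
  have -> : p k = m by apply/val_inj/eqP; rewrite eqn_leq m_max //= (andP (h m mA)).2.
  by rewrite eqxx ltnNge (andP (h t tA)).1.
have -> : p k != m.
  have below : (k <= p k)%N = false by rewrite -(h k kA) ltnn.
  by apply: contraFneq below => ->; apply: m_max.
by rewrite h //= ltn_neqAle tN.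
Qed.

Lemma solved_overshoots : (g == [ffun i => s i]) = (#|overshoots s g| == 0)%N.
Proof.
rewrite cards_eq0; apply/eqP/eqP => [g_s|o0].
  by apply/setP => i; rewrite !inE g_s ffunE permK ltnn.
apply/ffunP => i; rewrite ffunE; apply/eqP.
have [iA|] := boolP (i \in A); last by rewrite !inE negbK.
by have [m] := last_unsolved iA; rewrite o0 inE.
Qed.

End Round.

Lemma guess_circular_shift (n : nat) (s : 'S_n) (r : nat) :
  guess (@circular_shift n) s r.+2 =
  shift_word (guess (@circular_shift n) s r.+1)
             (feedback s (guess (@circular_shift n) s r.+1)).
Proof. by rewrite /guess /circular_shift /= foldl_rcons. Qed.

Lemma guess_inj (n : nat) (s : 'S_n) (r : nat) :
  injective (guess (@circular_shift n) s r.+1).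
Proof.
elim: r => [|r IH]; first by move=> i j; rewrite /guess /= !ffunE.
by rewrite guess_circular_shift; apply: shift_word_inj.
Qed.

Lemma card_overshoots_guess (n : nat) (s : 'S_n) (r : nat) :
  #|overshoots s (guess (@circular_shift n) s r.+1)| =
  (#|excedances s| - r)%N.
Proof.
elim: r => [|r IH]; last first.
  by rewrite guess_circular_shift overshoots_shift ?IH ?subnS //; apply: guess_inj.
rewrite subn0 -[RHS](card_imset _ (@perm_inj _ s)); congr #|pred_of_set _|.
apply/setP => i; rewrite -[i](permKV s) mem_imset; last exact: perm_inj.
by rewrite !inE /guess /= ffunE permK.
Qed.

(** Overshoots disappear one per round from the initial [exc s], so none is
    left precisely from round [exc s + 1] on. *)
Lemma solved_in_excedances (n : nat) (s : 'S_n) :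
  solved_in (@circular_shift n) s #|excedances s|.+1.
Proof.
have solvedE r : (guess (@circular_shift n) s r.+1 = [ffun i => s i]) <->
    (#|excedances s| <= r)%N.
  rewrite -subn_eq0 -card_overshoots_guess -solved_overshoots; last exact: guess_inj.
  by split=> /eqP.
split; first by split=> //; apply/solvedE.
by case=> [|q] [] // _ /solvedE.
Qed.

(** The value of a uniform permutation at [x] is uniformly distributed:
    composing with the transposition of [x] and [y] shows that the sum of
    [f (s x)] does not depend on [x], and for each [s] the sum of [f (s y)] over
    all [y] is that of [f]. *)
Lemma sum_perm_eval (T : finType) (f : T -> nat) (x : T) :
  (#|T| * \sum_(s : {perm T}) f (s x) = #|{perm T}| * \sum_(y : T) f y)%N.
Proof.
rewrite -!sum_nat_const.
transitivity (\sum_(y : T) \sum_(s : {perm T}) f (s y))%N.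
  apply: eq_bigr => y _; rewrite (reindex_inj (mulgI (tperm y x))).
  by apply: eq_bigr => s _; rewrite permM tpermR.
rewrite exchange_big; apply: eq_bigr => s _.
by rewrite [RHS](reindex_inj (@perm_inj _ s)).
Qed.

(** The ordered pairs split into [i < j], its mirror image, and the diagonal. *)
Lemma sum_ltn_ord (n : nat) :
  (2 * (\sum_(i < n) \sum_(j < n) (i < j)%N) + n = n * n)%N.
Proof.
rewrite mul2n -addnn {2}exchange_big -[X in (_ + X)%N]card_ord -sum1_card -!big_split.
have -> : (n * n = \sum_(i < n) n)%N by rewrite sum_nat_const card_ord.
apply: eq_bigr => i _ /=.
rewrite (bigD1 i) //= [X in (_ + X + _)%N](bigD1 i) //= ltnn !add0n.
rewrite -big_split /= (eq_bigr (fun=> 1%N)) => [|j].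
  by rewrite -[RHS]card_ord -[in RHS]sum1_card [in RHS](bigD1 i) //= addnC.
by rewrite -val_eqE /=; case: ltngtP.
Qed.

Lemma sum_excedances (n : nat) : (0 < n)%N ->
  (2 * (\sum_(s : 'S_n) #|excedances s|) + #|{: 'S_n}| = #|{: 'S_n}| * n)%N.
Proof.
move=> n_gt0; apply/eqP; rewrite -(eqn_pmul2l n_gt0); apply/eqP.
have card_exc (s : 'S_n) : #|excedances s| = (\sum_(i < n) (i < s i))%N.
  by rewrite -sum1_card big_mkcond; apply: eq_bigr => i _; rewrite inE; case: ltnP.
rewrite (eq_bigr _ (fun s _ => card_exc s)) exchange_big /=.
have total : (n * (\sum_(i < n) \sum_(s : 'S_n) (i < s i)) =
    #|{: 'S_n}| * \sum_(i < n) \sum_(j < n) (i < j))%N.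
  rewrite !big_distrr; apply: eq_bigr => i _ /=.
  by have := sum_perm_eval (fun j : 'I_n => (i < j)%N : nat) i; rewrite card_ord.
by rewrite mulnDr mulnCA total mulnCA [(n * #|_|)%N]mulnC -mulnDr sum_ltn_ord mulnCA.
Qed.

Theorem corollary9 (n : nat) (hn : (1 <= n)%N) :
  exists N : 'S_n -> nat,
    (forall s : 'S_n, solved_in (@circular_shift n) s (N s)) /\
    uniform_expectation (fun s : 'S_n => (N s)%:R) = (n%:R + 1) / 2%:R.
Proof.
exists (fun s => #|excedances s|.+1); split; first exact: solved_in_excedances.
rewrite /uniform_expectation -mulr_sumr.
have S_neq0 : #|{: 'S_n}|%:R != 0 :> rat.
  by rewrite pnatr_eq0 -lt0n; apply/card_gt0P; exists 1%g.
apply: (canLR (mulKf S_neq0)); rewrite mulrA; apply: (canRL (mulfK _)) => //.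
rewrite -natr_sum natr1 -!natrM; congr _%:R.
rewrite (eq_bigr (fun s => 1 + #|excedances s|)%N) // big_split /= sum1_card.
transitivity
    (#|{: 'S_n}| + (2 * (\sum_(s : 'S_n) #|excedances s|) + #|{: 'S_n}|))%N.
  by rewrite [RHS]addnCA addnn -mul2n [RHS]addnC -mulnDr mulnC.
by rewrite (sum_excedances hn) mulnS.
Qed.
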